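(* Let $P_n$ be the path on $n>2$ vertices $1,\dots,n$ with edges $e_i=\{i,i+1\}$ ($1\le i\le n-1$), let $f_j=\{j,j+2\}$ ($1\le j\le n-2$), let $B=\{e_1,f_1,\dots,e_{n-2},f_{n-2},e_{n-1}\}$, and let $\mathfrak{D}_{P_n}=\mathfrak{D}_2(P_n)[B,B]$. Write $\det(xI-\mathfrak{D}_{P_n})=\sum_{i=0}^{2n-3}a_ix^i$. If $|a_\ell|=\max\{|a_0|,|a_1|,\dots,|a_{2n-4}|\}$, then $\ell\le\lfloor\frac{7n}{5}\rfloor$.
   Context: For a tree $T$, let $\mathcal{V}_2$ be the set of 2-element vertex subsets (edges regarded as elements of $\mathcal{V}_2$). The 2-Steiner distance matrix $\mathfrak{D}_2(T)$ is indexed by $\mathcal{V}_2$, with entry in row $\{i,j\}$, column $\{k,l\}$ equal to the minimum number of edges of a connected subtree of $T$ whose vertex set contains $i,j,k,l$. $M[B,B]$ denotes the principal submatrix with rows and columns indexed by $B$. *)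

(* Defs.v *)
From mathcomp Require Import all_boot all_order all_algebra.
Set Implicit Arguments. Unset Strict Implicit. Unset Printing Implicit Defensive.
Import GRing.Theory Num.Theory.

(* Path P_n on vertices 1..n, edges {i,i+1}.  For the path, the minimum number
   of edges of a connected subtree (= subpath) containing vertices i,j,k,l is
   max(i,j,k,l) - min(i,j,k,l). *)
Definition steiner2_path (u v : nat * nat) : nat :=
  maxn (maxn u.1 u.2) (maxn v.1 v.2) - minn (minn u.1 u.2) (minn v.1 v.2).

(* The ordered list B = e_1, f_1, e_2, f_2, ..., e_{n-2}, f_{n-2}, e_{n-1},
   indexed from 0: index 2i is e_{i+1} = {i+1,i+2}, index 2i+1 is
   f_{i+1} = {i+1,i+3}. *)
Definition Bset (k : nat) : nat * nat :=
  if odd k then (k./2 + 1, k./2 + 3) else (k./2 + 1, k./2 + 2).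

Definition DPn (n : nat) : 'M[int]_(2 * n - 3) :=
  \matrix_(k, l) Posz (steiner2_path (Bset k) (Bset l)).

Definition coefDPn (n i : nat) : int := (char_poly (DPn n))`_i.

(* Main.v *)
Require Import Defs.
From mathcomp Require Import all_boot all_order all_algebra.
From mathcomp Require Import zify ring.
Import GRing.Theory Num.Theory.
Local Open Scope ring_scope.

(* With U the bidiagonal matrix of consecutive differences, U (xI - D) U^T is a
   tridiagonal Toeplitz matrix except for its last row and column.  Solving the
   tridiagonal system with the Fibonacci polynomials F_k (F_(k+2) = F_(k+1) + x F_k)
   gives, for N = 2n - 4 and p the characteristic polynomial,
     - (1 + 4x)^2 p = ((n-1) + (6n-3) x + 8n x^2) F_(2N+2)
                      + 2 x^2 F_(2N) - 8 x^4 F_(2N-1) - 2 x^(N+1) (1 + 2x)^2.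
   Let Q = (1 + 4x)^2 p.  If |a_l| is maximal, then |Q_(l+2)| >= (16 - 8 - 1) |a_l|
   and |Q_l| <= (1 + 8 + 16) |a_l|, hence 25 |Q_(l+2)| >= 7 |Q_l|.  But the
   coefficients 'C(2N + 1 - i, i) of F_(2N+2) shrink by a factor of at least 5/2 at
   each step once i exceeds about 7n/5, which makes 25 |Q_(l+2)| < 7 |Q_l| for
   l > 7n/5. *)

(** [Bset k] spans from [k./2 + 1] to [uphalf k + 2]. Both ends are nondecreasing in [k], so the
    smaller index fixes the left end of the hull and the larger one the right end. *)
Lemma steiner2_path_Bset (k l : nat) :
  steiner2_path (Bset k) (Bset l) = ((uphalf (maxn k l)).+1 - (minn k l)./2)%N.
Proof.
rewrite /steiner2_path /Bset; case: ifP => hk; case: ifP => hl /=; lia.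
Qed.

Section PathMatrix.

Variables (R : comNzRingType) (x : R).

(** * Fibonacci polynomials *)

Fixpoint fibp (k : nat) : R :=
  match k with
  | 0 => 0
  | k1.+1 => match k1 with 0 => 1 | k2.+1 => fibp k1 + x * fibp k2 end
  end.

Arguments fibp : simpl never.

Lemma fibp_small : (fibp 0 = 0) * (fibp 2 = 1) * (fibp 4 = 1 + 2 * x).
Proof. by do ![split]; rewrite /fibp; ring. Qed.

Lemma fibpSS (k : nat) : fibp k.+2 = fibp k.+1 + x * fibp k.
Proof. by []. Qed.

(** This is the recurrence of the leading minors of the tridiagonal Toeplitz matrix with diagonal
    [1 + 2 * x] and off-diagonals [- x]. *)
Lemma fibp_double_rec (k : nat) :
  fibp k.*2.+4 = (1 + 2 * x) * fibp k.*2.+2 - x ^+ 2 * fibp k.*2.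
Proof. by rewrite !fibpSS; ring. Qed.

(** * Differencing to a bordered tridiagonal matrix *)

Lemma sum_pick (n i : nat) (f : nat -> R) :
  \sum_(j < n) (i == j)%:R * f j = (i < n)%N%:R * f i.
Proof.
elim: n => [|n IH]; first by rewrite big_ord0 ltn0 mul0r.
rewrite big_ord_recr /= IH ltnS [(i <= n)%N]leq_eqVlt.
by case: eqVneq => [->|_] /=; rewrite ?ltnn ?mulr0n ?mul0r ?add0r ?addr0.
Qed.

Lemma sum_pick_pred (n i : nat) (f : nat -> R) : (i <= n)%N ->
  \sum_(j < n) (j.+1 == i)%:R * f j = (0 < i)%N%:R * f i.-1.
Proof.
case: i => [|i] hi /=; first by rewrite big1 ?mul0r // => j _; rewrite mul0r.
under eq_bigr => j _ do rewrite eqSS eq_sym.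
by rewrite sum_pick hi.
Qed.

Definition pathmx_entry (i j : nat) : R :=
  (i == j)%:R * x - ((uphalf (maxn i j)).+1 - (minn i j)./2)%N%:R.

Definition diffmx (N : nat) : 'M[R]_N.+1 :=
  \matrix_(i, j) ((i == j :> nat)%:R - (i.+1 == j)%:R).

Lemma sum_diffmx (N : nat) (i : 'I_N.+1) (f : nat -> R) :
  \sum_(j < N.+1) diffmx N i j * f j = f i - (i < N)%N%:R * f i.+1.
Proof.
under eq_bigr => j _ do rewrite mxE mulrBl.
by rewrite sumrB !sum_pick ltn_ord mul1r.
Qed.

Lemma det_diffmx (N : nat) : \det (diffmx N) = 1.
Proof.
rewrite -det_tr det_trig; last first.
  apply/is_trig_mxP => i j hij; rewrite !mxE.
  by rewrite (_ : (j == i :> nat) = false) 1?(_ : (j.+1 == i) = false) ?subrr //; lia.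
rewrite big1 // => i _; rewrite !mxE eqxx (_ : (i.+1 == i) = false) ?subr0 //; lia.
Qed.

Definition bordered_entry (N i j : nat) : R :=
  (i == j)%:R * (1 + 2 * x - (i == N)%:R * (x + 2)) - (i.+1 == j)%:R * x
  - (j.+1 == i)%:R * x - (j == N)%:R * (odd i)%:R - (i == N)%:R * (odd j)%:R.

Lemma pathmx_entry_sym (i j : nat) : pathmx_entry i j = pathmx_entry j i.
Proof. by rewrite /pathmx_entry eq_sym maxnC minnC. Qed.

Lemma pathmx_entry_le (i j : nat) : (i <= j)%N ->
  pathmx_entry i j = (i == j)%:R * x - (uphalf j)%:R - 1 + (i./2)%:R.
Proof.
move=> hij; rewrite /pathmx_entry (maxn_idPr hij) (minn_idPl hij) natrB; last lia.
by rewrite -addn1 natrD; ring.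
Qed.

Lemma uphalfS_natr (i : nat) : (uphalf i.+1)%:R = (uphalf i)%:R + 1 - (odd i)%:R :> R.
Proof.
have -> : uphalf i.+1 = (uphalf i + 1 - odd i)%N by lia.
by rewrite natrB ?natrD //; lia.
Qed.

Lemma halfS_natr (i : nat) : (i.+1./2)%:R = (i./2)%:R + (odd i)%:R :> R.
Proof. by rewrite -natrD; congr (_%:R); lia. Qed.

Lemma bordered_entry_sym (N i j : nat) : bordered_entry N i j = bordered_entry N j i.
Proof.
rewrite /bordered_entry; case: (eqVneq i j) => [->//|_] /=; ring.
Qed.

(** Strictly above the diagonal an entry is a function of [i] plus a function of [j], so mixed
    differences vanish away from the diagonal. The last column is differenced in [i] only and keeps
    the jumps [odd i] of [i./2]. *)
Lemma pathmx_entry_diff (N i j : nat) : ~~ odd N -> (i <= N)%N -> (j <= N)%N ->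
  pathmx_entry i j - (i < N)%N%:R * pathmx_entry i.+1 j
  - (j < N)%N%:R * (pathmx_entry i j.+1 - (i < N)%N%:R * pathmx_entry i.+1 j.+1)
  = bordered_entry N i j.
Proof.
move=> oN; wlog hij : i j / (i <= j)%N => [hw | ] hi hj.
  have [hij|hji] := leqP i j; first exact: hw.
  rewrite bordered_entry_sym -(hw j i (ltnW hji) hj hi).
  rewrite !(pathmx_entry_sym i) !(pathmx_entry_sym i.+1); ring.
have ltN k : (k <= N)%N -> (k < N)%N%:R = 1 - (k == N)%:R :> R.
  by move=> hk; rewrite ltn_neqAle hk andbT; case: eqP; rewrite ?subrr ?subr0.
rewrite !ltN // /bordered_entry.
have [hlt|hle] := ltnP i j; last first.
  have {hle hij} -> : j = i by lia.
  rewrite (pathmx_entry_sym i.+1 i) !pathmx_entry_le ?leqnn ?leqnSn //.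
  rewrite !uphalfS_natr !halfS_natr !eqxx (_ : (i == i.+1) = false)
    1?(_ : (i.+1 == i) = false); try lia.
  case: (eqVneq i N) => [->|_] /=; last ring.
  rewrite (negbTE oN) /=; ring.
rewrite !pathmx_entry_le; try lia.
rewrite !uphalfS_natr !halfS_natr eqSS (_ : (i == j) = false) 1?(_ : (i == j.+1) = false)
  1?(_ : (j.+1 == i) = false) 1?(_ : (i == N) = false); try lia.
case: (eqVneq j N) => [->|_] /=; last ring.
rewrite ?(negbTE oN) /=; ring.
Qed.

Lemma diffmx_conj (N : nat) : ~~ odd N ->
  diffmx N *m (\matrix_(i, j) pathmx_entry i j) *m (diffmx N)^T
  = \matrix_(i, j) bordered_entry N i j.
Proof.
move=> oN; apply/matrixP => i j; rewrite -mulmxA mxE [RHS]mxE.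
rewrite -(pathmx_entry_diff _ _ _ oN) -1?ltnS //.
pose g (k l : nat) := pathmx_entry k l - (l < N)%N%:R * pathmx_entry k l.+1.
transitivity (\sum_(k < N.+1) diffmx N i k * g k j).
  apply: eq_bigr => k _; congr (_ * _); rewrite mxE.
  rewrite /g -(sum_diffmx _ j (pathmx_entry k)); apply: eq_bigr => l _.
  by rewrite !mxE mulrC.
rewrite (sum_diffmx _ i (fun k => g k j)) /g; ring.
Qed.

Lemma det_pathmx (N : nat) : ~~ odd N ->
  \det (\matrix_(i < N.+1, j < N.+1) pathmx_entry i j)
  = \det (\matrix_(i < N.+1, j < N.+1) bordered_entry N i j).
Proof.
by move=> oN; rewrite -diffmx_conj // !det_mulmx det_tr det_diffmx mul1r mulr1.
Qed.

(** * Solving the tridiagonal system *)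

Lemma sum_bordered (N i : nat) (f : nat -> R) : ~~ odd N -> (i <= N)%N ->
  \sum_(j < N.+1) bordered_entry N i j * f j =
  (1 + 2 * x - (i == N)%:R * (x + 2)) * f i - (i < N)%N%:R * x * f i.+1
  - (0 < i)%N%:R * x * f i.-1 - (odd i)%:R * f N
  - (i == N)%:R * \sum_(j < N.+1) (odd j)%:R * f j.
Proof.
move=> oN hi.
transitivity (\sum_(j < N.+1) ((1 + 2 * x - (i == N)%:R * (x + 2)) * ((i == j)%:R * f j)
  - x * ((i.+1 == j)%:R * f j) - x * ((j.+1 == i)%:R * f j)
  - (odd i)%:R * ((N == j)%:R * f j) - (i == N)%:R * ((odd j)%:R * f j))).
  by apply: eq_bigr => j _; rewrite /bordered_entry (eq_sym N j); ring.
rewrite !sumrB -!mulr_sumr !sum_pick (sum_pick_pred _ _ _ (leqW hi)).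
by rewrite !ltnS leqnn hi !mul1r; ring.
Qed.

(* A solution of x (s_(k-1) + s_(k+1)) = (1 + 2x) s_k, normalised so that its values
   at k = N and k = -1 are F_(2N+2) and - F_(2N+2). *)
Definition homsol (N k : nat) : R :=
  x ^+ (N - k) * fibp k.*2.+2 - x ^+ k.+1 * fibp (N - k).*2.

Lemma homsol_rec (N k : nat) : (k.+2 <= N)%N ->
  x * (homsol N k + homsol N k.+2) = (1 + 2 * x) * homsol N k.+1.
Proof.
move=> hk; have [m ->] : exists m, N = (k + m.+2)%N by exists (N - k.+2)%N; lia.
rewrite /homsol.
have -> : (k + m.+2 - k = m.+2)%N by lia.
have -> : (k + m.+2 - k.+1 = m.+1)%N by lia.
have -> : (k + m.+2 - k.+2 = m)%N by lia.
have := fibp_double_rec k.+1; rewrite !doubleS => ->; rewrite (fibp_double_rec m).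
rewrite !exprS; ring.
Qed.

Lemma homsol_first (N : nat) : (0 < N)%N ->
  x * homsol N 1 = (1 + 2 * x) * homsol N 0 + x * fibp N.*2.+2.
Proof.
case: N => // N _; rewrite /homsol subn0 subSS subn0 !doubleS (fibp_double_rec N).
rewrite /= !fibp_small !exprS; ring.
Qed.

Lemma homsol_last (N : nat) : homsol N N = fibp N.*2.+2.
Proof. rewrite /homsol subnn /= fibp_small expr0; ring. Qed.

Lemma homsol_zero (N : nat) : homsol N 0 = x ^+ N - x * fibp N.*2.
Proof. rewrite /homsol subn0 /= fibp_small; ring. Qed.

Lemma homsol_prelast (N : nat) : homsol N.+1 N = x * fibp N.+1.*2 - x ^+ N.+1.
Proof. rewrite /homsol subSnn /= fibp_small; ring. Qed.

(** Summing [homsol_rec] over odd centres and over even centres relates the odd and even sums.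
    Eliminating the even sum leaves the factor [(1 + 2x)^2 - 4x^2 = 1 + 4x] and boundary terms. *)
Lemma sum_odd_homsol (N M : nat) : (M.+1.*2 <= N)%N ->
  (1 + 4 * x) * \sum_(j < M.+1.*2.+1) (odd j)%:R * homsol N j =
  x * ((1 + 2 * x) * homsol N M.+1.*2 - 2 * x * homsol N M.*2.+1
       - 2 * x * homsol N 1 + (1 + 2 * x) * homsol N 0).
Proof.
elim: M => [|M IH] hM.
  rewrite !big_ord_recl big_ord0 /=.
  have /(congr1 (fun u => u - (1 + 2 * x) * homsol N 1)) := homsol_rec N 0 hM.
  rewrite subrr => E.
  apply/subr0_eq; transitivity (- (1 + 2 * x) *
    (x * (homsol N 0 + homsol N 2) - (1 + 2 * x) * homsol N 1)); last by rewrite E mulr0.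
  ring.
rewrite doubleS big_ord_recr big_ord_recr /= mulrDr mulrDr IH; last by lia.
have := homsol_rec N M.+1.*2 hM.
have := homsol_rec N M.*2.+1 (ltnW hM).
rewrite !doubleS /= !odd_double /=.
move: (homsol N _) (homsol N _) (homsol N _) (homsol N _) => d b c a E1 E2.
apply/subr0_eq; transitivity (- 2 * x * (x * (a + c) - (1 + 2 * x) * b)
  - (1 + 2 * x) * (x * (b + d) - (1 + 2 * x) * c)); last by rewrite E1 E2 !subrr; ring.
ring.
Qed.

(* The tridiagonal system with right-hand side the indicator of odd indices has the
   bounded solution (2x + [k odd]) / (1 + 4x); adding a multiple of [homsol] makes
   it meet the boundary conditions at k = -1 and k = N. *)
Definition lastcol (N k : nat) : R :=
  fibp N.*2.+2 * (2 * x + (odd k)%:R) + (1 + 2 * x) * homsol N k.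

Lemma lastcol_last (N : nat) : ~~ odd N ->
  lastcol N N = (1 + 4 * x) * fibp N.*2.+2.
Proof. move=> oN; rewrite /lastcol (negbTE oN) homsol_last /=; ring. Qed.

Lemma bordered_lastcol (N i : nat) : ~~ odd N -> (i < N)%N ->
  (1 + 2 * x) * lastcol N i - x * lastcol N i.+1
  - (0 < i)%N%:R * x * lastcol N i.-1 - (odd i)%:R * lastcol N N = 0.
Proof.
move=> oN hi; rewrite lastcol_last // /lastcol.
case: i hi => [|i] hi /=.
  (* Row 0 has no left neighbour; this fits because [lastcol] extended to -1 is
     [F (2x + 1) - (1 + 2x) F = 0], with F the polynomial [fibp N.*2.+2]. *)
  have E := homsol_first _ hi.
  transitivity (- (1 + 2 * x) * (x * homsol N 1
    - ((1 + 2 * x) * homsol N 0 + x * fibp N.*2.+2))); last by rewrite E subrr mulr0.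
  ring.
have E := homsol_rec _ _ hi.
transitivity (- (1 + 2 * x) * (x * (homsol N i + homsol N i.+2)
    - (1 + 2 * x) * homsol N i.+1)); last by rewrite E subrr mulr0.
by case: (odd i) => /=; ring.
Qed.

(* The last entry of the product of the bordered matrix and [lastcol]; its other
   entries vanish by [bordered_lastcol]. *)
Definition dlast (N : nat) : R :=
  (x - 1) * lastcol N N - x * lastcol N N.-1
  - \sum_(j < N.+1) (odd j)%:R * lastcol N j.

Lemma sum_odd_double (M : nat) : \sum_(j < M.*2.+1) (odd j)%:R = M%:R :> R.
Proof.
elim: M => [|M IH]; first by rewrite big_ord_recl big_ord0 /= addr0.
by rewrite doubleS big_ord_recr big_ord_recr /= IH odd_double /= addr0 natr1.
Qed.

Lemma dlastE (M N : nat) : (0 < M)%N -> N = M.*2 ->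
  (1 + 4 * x) * dlast N = - (
    ((M%:R + 1) + (6 * M%:R + 9) * x + 8 * (M%:R + 2) * x ^+ 2) * fibp N.*2.+2
    + 2 * x ^+ 2 * fibp N.*2 - 8 * x ^+ 4 * fibp N.*2.-1
    - 2 * x ^+ N.+1 * (1 + 2 * x) ^+ 2).
Proof.
case: M => // M _ EN; rewrite /dlast.
have -> : \sum_(j < N.+1) (odd j)%:R * lastcol N j =
  fibp N.*2.+2 * (1 + 2 * x) * M.+1%:R
  + (1 + 2 * x) * \sum_(j < N.+1) (odd j)%:R * homsol N j.
  rewrite -(sum_odd_double M.+1) -EN !mulr_sumr -big_split /=.
  by apply: eq_bigr => j _; rewrite /lastcol; case: (odd j) => /=; ring.
have := sum_odd_homsol N M; rewrite -EN => /(_ (leqnn N)).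
move: (\sum_(j < N.+1) _) => S.
have oN : ~~ odd N by rewrite EN odd_double.
rewrite lastcol_last // homsol_last.
have N1 : N = N.-1.+1 by rewrite EN.
have o1 : odd N.-1 by rewrite EN doubleS /= odd_double.
rewrite /lastcol o1 homsol_zero.
have -> : M.*2.+1 = N.-1 by rewrite EN.
have -> : homsol N N.-1 = x * fibp N.*2 - x ^+ N by rewrite {1}N1 homsol_prelast -N1.
have N0 : (0 < N)%N by rewrite N1.
have := homsol_first _ N0; rewrite homsol_zero.
have -> : fibp N.*2.+2 = fibp N.*2.+1 + x * fibp N.*2 by [].
have -> : fibp N.*2.+1 = fibp N.*2 + x * fibp N.*2.-1 by rewrite EN doubleS.
rewrite -(natr1 M) (exprS x N).
move: (homsol N 1) (fibp N.*2) (fibp N.*2.-1) (x ^+ N) (M%:R) => s a c y m E hS.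
(* The multipliers are chosen to cancel [S] and then [s], the only quantities not expressed through
   [a], [c], [y], [m]. *)
apply/subr0_eq; transitivity (2 * x * (1 + 2 * x) * (x * s -
   ((1 + 2 * x) * (y - x * a) + x * (a + x * c + x * a)))
   - (1 + 2 * x) * ((1 + 4 * x) * S - x * ((1 + 2 * x) * (a + x * c + x * a)
   - 2 * x * (x * a - y) - 2 * x * s + (1 + 2 * x) * (y - x * a))));
  last by rewrite E hS; ring.
rewrite /=; ring.
Qed.

(** * Triangularisation and the determinant *)

(* Columns of an upper triangular matrix whose product with the bordered matrix is
   lower triangular. *)
Definition trigcol (N k j : nat) : R :=
  if (j < N)%N then (k <= j)%N%:R * (x ^+ (j - k) * fibp k.*2.+2) else lastcol N k.

(** For [j < N] the weight [x ^+ (j - k)] turns [fibp_double_rec] into the row equation, and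
    [fibp 0 = 0] settles row 0. *)
Lemma bordered_trigcol (N i j : nat) : ~~ odd N -> (i < j)%N -> (j <= N)%N ->
  \sum_(k < N.+1) bordered_entry N i k * trigcol N k j = 0.
Proof.
move=> oN hij hj; have hi : (i < N)%N by apply: leq_trans hj.
rewrite (sum_bordered _ _ (fun k => trigcol N k j) oN (ltnW hi)).
rewrite (_ : (i == N) = false) ?hi; last lia.
rewrite /trigcol; have [hjN|_] := ltnP j N; last first.
  rewrite -(bordered_lastcol _ _ oN hi) /=; ring.
rewrite (_ : (i <= j)%N) 1?(_ : (i.+1 <= j)%N) 1?(_ : (i.-1 <= j)%N)
  1?(_ : (N <= j)%N = false); try lia.
have [m ->] : exists m, j = (i + m.+1)%N by exists (j - i.+1)%N; lia.
have -> : (i + m.+1 - i = m.+1)%N by lia.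
have -> : (i + m.+1 - i.+1 = m)%N by lia.
case: i hij hi => [|i] hij hi /=; first by rewrite !fibp_small exprS; ring.
have -> : (i.+1 + m.+1 - i = m.+2)%N by lia.
have := fibp_double_rec i.+1; rewrite !doubleS => ->; rewrite !exprS; ring.
Qed.

Lemma bordered_trigcol_diag (N i : nat) : ~~ odd N -> (i < N)%N ->
  \sum_(k < N.+1) bordered_entry N i k * trigcol N k i = fibp i.+1.*2.+2.
Proof.
move=> oN hi; rewrite (sum_bordered _ _ (fun k => trigcol N k i) oN (ltnW hi)).
rewrite (_ : (i == N) = false) ?hi; last lia.
rewrite /trigcol hi leqnn ltnn (_ : (i.-1 <= i)%N) 1?(_ : (N <= i)%N = false); try lia.
rewrite subnn doubleS fibp_double_rec.
case: i hi => [|i] hi /=; first by rewrite !fibp_small; ring.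
rewrite subSnn; ring.
Qed.

Lemma bordered_trigcol_last (N : nat) : ~~ odd N -> (0 < N)%N ->
  \sum_(k < N.+1) bordered_entry N N k * trigcol N k N = dlast N.
Proof.
move=> oN hN; rewrite (sum_bordered _ _ (fun k => trigcol N k N) oN (leqnn N)).
rewrite /trigcol ltnn eqxx hN (negbTE oN) /dlast /=; ring.
Qed.

(** Compares [\det B * \det Y] with [\det (B *m Y)]. The common factors stay because [R] need not be
    a domain. *)
Lemma det_bordered (N : nat) : ~~ odd N -> (0 < N)%N ->
  \det (\matrix_(i < N.+1, j < N.+1) bordered_entry N i j)
  * ((\prod_(k < N) fibp k.*2.+2) * ((1 + 4 * x) * fibp N.*2.+2))
  = (\prod_(k < N) fibp k.*2.+2) * (fibp N.*2.+2 * dlast N).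
Proof.
move=> oN N0; set B := \matrix_(i, j) _.
pose Y : 'M[R]_N.+1 := \matrix_(k, j) trigcol N k j.
have BY (i j : 'I_N.+1) : (B *m Y) i j = \sum_(k < N.+1) bordered_entry N i k * trigcol N k j.
  by rewrite mxE; apply: eq_bigr => k _; rewrite !mxE.
have detY : \det Y = (\prod_(k < N) fibp k.*2.+2) * ((1 + 4 * x) * fibp N.*2.+2).
  rewrite -det_tr det_trig; last first.
    apply/is_trig_mxP => i j hij; rewrite !mxE /trigcol.
    have -> : (i < N)%N by have := ltn_ord j; lia.
    by rewrite leqNgt hij mul0r.
  rewrite big_ord_recr !mxE /= /trigcol ltnn lastcol_last //; congr (_ * _).
  by apply: eq_bigr => i _; rewrite !mxE /= /trigcol ltn_ord leqnn subnn expr0 !mul1r.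
rewrite -detY -det_mulmx det_trig; last first.
  by apply/is_trig_mxP => i j hij; rewrite BY bordered_trigcol // -ltnS.
rewrite big_ord_recr /= BY bordered_trigcol_last // mulrA; congr (_ * _).
(* The diagonal of the product is shifted by one index; the shift costs nothing since
   [fibp 2 = 1]. *)
transitivity (\prod_(k < N.+1) fibp k.*2.+2); last by rewrite big_ord_recr.
rewrite big_ord_recl /= fibp_small mul1r; apply: eq_bigr => i _.
by rewrite BY bordered_trigcol_diag /= ?ltn_ord ?/bump ?add1n.
Qed.

End PathMatrix.

Arguments fibp {R} x k : simpl never.
Arguments pathmx_entry {R} x i j.
Arguments dlast {R} x N.

(** * The characteristic polynomial *)

Lemma coef_fibp (k i : nat) : (fibp 'X k.+1)`_i = 'C(k - i, i)%:R :> int.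
Proof.
suff: (forall i, (fibp 'X k.+1)`_i = 'C(k - i, i)%:R :> int) /\
      (forall i, (fibp 'X k.+2)`_i = 'C(k.+1 - i, i)%:R :> int) by case.
elim: k {i} => [|k [IH1 IH2]].
  split=> i; rewrite /fibp ?mulr0 ?addr0 coef1; first by case: i.
  by case: i => [|[|i]].
split=> // i; rewrite fibpSS coefD coefXM IH2; case: i => [|i] /=.
  by rewrite !bin0.
rewrite IH1 -natrD; congr (_%:R); rewrite !subSS.
have [hi|hi] := leqP i k; first by rewrite subSn // binS.
have -> : (k - i = 0)%N by lia.
have -> : (k.+1 - i = 0)%N by lia.
by rewrite !bin0n; case: (i) hi.
Qed.

Lemma fibp_neq0 (k : nat) : fibp 'X k.+1 != 0 :> {poly int}.
Proof.
apply/eqP => /(congr1 (fun p : {poly int} => p`_0)).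
by rewrite coef_fibp bin0 coef0.
Qed.

Lemma char_poly_DPn (m N : nat) : N = m.+1.*2 ->
  (1 + 4 * 'X) ^+ 2 * char_poly (DPn m.+3) = - (
    (m.+2%:R + (6 * m.+1%:R + 9) * 'X + 8 * m.+3%:R * 'X ^+ 2) * fibp 'X N.*2.+2
    + 2 * 'X ^+ 2 * fibp 'X N.*2 - 8 * 'X ^+ 4 * fibp 'X N.*2.-1
    - 2 * 'X ^+ N.+1 * (1 + 2 * 'X) ^+ 2).
Proof.
move=> EN; have oN : ~~ odd N by rewrite EN odd_double.
have N0 : (0 < N)%N by rewrite EN.
have -> : char_poly (DPn m.+3) = \det (\matrix_(i < N.+1, j < N.+1) pathmx_entry 'X i j).
  rewrite /char_poly /char_poly_mx /DPn.
  have -> : (2 * m.+3 - 3 = N.+1)%N by lia.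
  congr (\det _); apply/matrixP => i j; rewrite !mxE steiner2_path_Bset /pathmx_entry.
  rewrite -[i == j]/(i == j :> nat); congr (_ - _); first by rewrite mulr_natl.
  by rewrite -polyC_natr natz.
rewrite det_pathmx // expr2 -mulrA.
have := dlastE {poly int} 'X m.+1 N isT EN.
have := det_bordered {poly int} 'X N oN N0.
pose P : {poly int} := \prod_(k < N) fibp 'X k.*2.+2.
set q := \det _; set F := fibp 'X N.*2.+2; rewrite -/P => E1 E2.
(* Integer polynomials form a domain, so [P] and [F] cancel. *)
have P0 : P != 0 by apply/prodf_neq0 => k _; apply: fibp_neq0.
have F0 : F != 0 by apply: fibp_neq0.
have -> : (1 + 4 * 'X) * q = dlast 'X N.
  apply: (mulfI (mulf_neq0 P0 F0)); rewrite -[RHS]mulrA -E1; ring.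
rewrite E2 !natr1 -(natr1 m.+2) -(natr1 m.+1); ring.
Qed.

(** * Ratios of binomial coefficients *)

Lemma bin_shift_diag (M i : nat) :
  ('C(M.+1, i.+2) * (i.+2 * i.+1) = M.+1 * (M - i) * 'C(M, i))%N.
Proof.
by rewrite mulnA (mulnC _ i.+2) -mul_bin_diag -mulnA (mulnC _ i.+1) mul_bin_left mulnA.
Qed.

Lemma bin_shift_antidiag (M i : nat) :
  ('C(M, i.+1) * (i.+1 * M.+1) = (M - i) * (M.+1 - i) * 'C(M.+1, i))%N.
Proof.
rewrite mulnA (mulnC _ i.+1) mul_bin_left -!mulnA; congr (_ * _)%N.
by rewrite mulnC -mul_bin_down mulnC.
Qed.

(** The bound [5 * i + 9] is what [7 * n < 5 * l] yields at [i = l - 2], the lowest index needed. *)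
Lemma fib_bin_ratio (n i : nat) : (2 < n)%N -> (7 * n <= 5 * i + 9)%N ->
  (5 * 'C(4 * n - 7 - i.+1, i.+1) <= 2 * 'C(4 * n - 7 - i, i))%N.
Proof.
move=> hn hi; have [hiN|hiN] := leqP (2 * n - 4) i.
  by rewrite bin_small ?muln0 //; lia.
have [M EM] : exists M, (4 * n - 7 - i = M.+1)%N by exists (4 * n - 8 - i)%N; lia.
have -> : (4 * n - 7 - i.+1 = M)%N by lia.
rewrite EM; have := bin_shift_antidiag M i.
move: 'C(M, i.+1) 'C(M.+1, i) => b1 b0 E.
have [A EA] : exists A, (M = A + i)%N by exists (M - i)%N; lia.
(* With [r = (A + 1) / (i + 1)] it suffices that [5 r^2 <= 2 (1 + r)]; [r = 6/7] just meets this,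
   180/49 against 182/49. *)
have h : (5 * (A * A.+1) <= 2 * (i.+1 * M.+1))%N.
  have h1 : (7 * A.+1 <= 6 * i.+1)%N by lia.
  have h2 := leq_mul (leqnn A) h1; have h3 := leq_mul (leqnn i.+1) h1.
  by rewrite EA; clear -h2 h3; lia.
have E' : (b1 * (i.+1 * M.+1) = A * A.+1 * b0)%N.
  by rewrite E; congr (_ * _ * _)%N; lia.
rewrite -(leq_pmul2r (_ : 0 < i.+1 * M.+1)%N) // -mulnA E'.
by have := leq_mul h (leqnn b0); clear; lia.
Qed.

(** Controls the negative term [- 8 x^4 F_(2N-1)] by the coefficients of [F_(2N+2)]. *)
Lemma fib_bin_step (N i : nat) : (i.+2 <= N)%N ->
  (2 * (N - i.+1) * 'C(2 * N - 2 - i, i) <= N * 'C(2 * N + 1 - i.+2, i.+2))%N.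
Proof.
move=> hi; have -> : (2 * N + 1 - i.+2 = (2 * N - 2 - i).+1)%N by lia.
have := bin_shift_diag (2 * N - 2 - i) i.
have -> : (2 * N - 2 - i - i = 2 * (N - i.+1))%N by lia.
have : (N.+1 <= (2 * N - 2 - i).+1)%N by lia.
move: (2 * N - 2 - i)%N => M hM.
move: 'C(M.+1, i.+2) 'C(M, i) (2 * (N - i.+1))%N => b e t E.
have h : (i.+2 * i.+1 <= N * N.+1)%N by apply: leq_mul; lia.
rewrite -(leq_pmul2l (_ : 0 < N.+1)%N) //.
have : (N.+1 * (t * e) <= M.+1 * (t * e))%N by rewrite leq_mul2r hM orbT.
have -> : (M.+1 * (t * e) = b * (i.+2 * i.+1))%N by rewrite E mulnA.
move/leq_trans; apply; rewrite mulnC mulnA (mulnC N.+1).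
by rewrite leq_mul2r h orbT.
Qed.

(** * Comparison of coefficients *)

(* The coefficient of x^(j+4) in - (1 + 4x)^2 p for n = m + 3.  The truncated
   subtractions are harmless: a top argument truncated to 0 makes the binomial 0, as
   its lower argument is then positive. *)
Definition coefQ (m j : nat) : int :=
  'C(4 * m + 5 - j.+4, j.+4)%:R *+ m.+2 + 'C(4 * m + 5 - j.+3, j.+3)%:R *+ (6 * m + 15)
  + 'C(4 * m + 5 - j.+2, j.+2)%:R *+ (8 * m.+3) + 'C(4 * m + 3 - j.+2, j.+2)%:R *+ 2
  - 'C(4 * m + 2 - j, j)%:R *+ 8
  - (j.+4 == m.*2 + 3)%N%:R *+ 2 - (j.+4 == m.*2 + 4)%N%:R *+ 8
  - (j.+4 == m.*2 + 5)%N%:R *+ 8.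

Lemma coefDPn_rec (m j : nat) :
  coefDPn m.+3 j.+4 + 8 * coefDPn m.+3 j.+3 + 16 * coefDPn m.+3 j.+2 = - coefQ m j.
Proof.
rewrite /coefDPn; have := char_poly_DPn m _ erefl; set p := char_poly _.
have -> : (1 + 4 * 'X) ^+ 2 * p = p + ('X^1 * p) *+ 8 + ('X^2 * p) *+ 16 by ring.
have -> : (m.+1.*2.*2.+2 = (4 * m + 5).+1)%N by lia.
have -> : (m.+1.*2.*2.-1 = (4 * m + 2).+1)%N by lia.
have -> : (m.+1.*2.*2 = (4 * m + 3).+1)%N by lia.
have -> : (m.+1.*2.+1 = m.*2 + 3)%N by lia.
set F := fibp _ _; set D := fibp _ _; set E := fibp _ _.
have -> : - ((m.+2%:R + (6 * m.+1%:R + 9) * 'X + 8 * m.+3%:R * 'X ^+ 2) * F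
    + 2 * 'X ^+ 2 * D - 8 * 'X ^+ 4 * E - 2 * 'X ^+ (m.*2 + 3) * (1 + 2 * 'X) ^+ 2)
  = - (F *+ m.+2 + ('X^1 * F) *+ (6 * m + 15) + ('X^2 * F) *+ (8 * m.+3)
    + ('X^2 * D) *+ 2 - ('X^4 * E) *+ 8 - 'X^(m.*2 + 3) *+ 2 - 'X^(m.*2 + 4) *+ 8
    - 'X^(m.*2 + 5) *+ 8).
  have -> : (m.*2 + 5 = (m.*2 + 3).+2)%N by lia.
  have -> : (m.*2 + 4 = (m.*2 + 3).+1)%N by lia.
  rewrite !exprS; ring.
move/(congr1 (fun q : {poly int} => q`_j.+4)).
rewrite !(coefMn, coefN, coefD, coefXnM, coefXn) !ltnS !ltn0 /= !subSS !subn0 !coef_fibp.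
by rewrite !mulr_natl => ->.
Qed.

(** Two steps of ratio 2/5 shrink the [F_(2N+2)] terms to 4/25; the slack up to 7/25 pays for the
    other terms. *)
Lemma coefQ_ratio (m j : nat) : (7 * m.+3 < 5 * j.+4)%N -> (j.+4 <= m.*2.+2)%N ->
  25 * `|coefQ m j.+2| < 7 * coefQ m j.
Proof.
move=> h1 h2.
have rat k : (j.+2 <= k)%N ->
    (5 * 'C(4 * m + 5 - k.+1, k.+1) <= 2 * 'C(4 * m + 5 - k, k))%N.
  move=> hk; have -> : (4 * m + 5 = 4 * m.+3 - 7)%N by lia.
  by apply: fib_bin_ratio; lia.
have r0 := rat _ (leqnn _); have r1 := rat _ (leqW (leqnn _)).
have r2 := rat _ (leqW (leqW (leqnn _))).
have r3 := rat _ (leqW (leqW (leqW (leqnn _)))).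
have stp k : (k.+2 <= m.*2.+2)%N ->
    ((m.*2.+2 - k.+1) * 'C(4 * m + 2 - k, k) <= m.+1 * 'C(4 * m + 5 - k.+2, k.+2))%N.
  move=> hk; have := fib_bin_step m.*2.+2 k hk.
  have -> : (2 * m.*2.+2 - 2 = 4 * m + 2)%N by lia.
  have -> : (2 * m.*2.+2 + 1 = 4 * m + 5)%N by lia.
  by rewrite -doubleS -mul2n -!mulnA leq_pmul2l.
have e0 := stp j (ltnW (ltnW h2)); have e2 := stp j.+2 h2.
have d : ('C(4 * m + 3 - j.+4, j.+4) <= 'C(4 * m + 5 - j.+4, j.+4))%N.
  by apply: leq_bin2l; lia.
have b0 : (0 < 'C(4 * m + 5 - j.+2, j.+2))%N by rewrite bin_gt0; lia.
have nm (a k : nat) : a%:R *+ k = (a * k)%N :> int by rewrite -mulr_natr -natrM natz.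
rewrite /coefQ !nm.
have -> : (j.+4 == m.*2 + 3)%N = false by lia.
have -> : (j.+4 == m.*2 + 4)%N = false by lia.
have -> : (j.+4 == m.*2 + 5)%N = false by lia.
move: (j.+2.+4 == m.*2 + 3)%N (j.+2.+4 == m.*2 + 4)%N => t1 t2.
have -> : (j.+2.+4 == m.*2 + 5)%N = false by lia.
have {e0} e0 : (3 * 'C(4 * m + 2 - j, j) <= m.+1 * 'C(4 * m + 5 - j.+2, j.+2))%N.
  by apply: leq_trans e0; rewrite leq_mul2r; apply/orP; right; lia.
have {e2} e2 : ('C(4 * m + 2 - j.+2, j.+2) <= m.+1 * 'C(4 * m + 5 - j.+4, j.+4))%N.
  by apply: leq_trans e2; rewrite leq_pmull //; lia.
have hm : (3 < m)%N by lia.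
clear nm rat stp h1 h2.
move: 'C(4 * m + 2 - j, j) 'C(4 * m + 2 - j.+2, j.+2) 'C(4 * m + 3 - j.+2, j.+2)
  'C(4 * m + 3 - j.+4, j.+4) e0 e2 d => c0 c2 d0 d2 e0 e2 d.
move: (binomial _ j.+2) (binomial _ j.+3) (binomial _ j.+4) (binomial _ j.+4.+1)
  (binomial _ j.+4.+2) b0 r0 r1 r2 r3 e0 e2 d => B0 B1 B2 B3 B4 b0 r0 r1 r2 r3 e0 e2 d.
(* The goal is linear once products such as [m * B0] count as atoms, so the inequalities are also
   supplied multiplied by [m]. *)
have s0 := leq_mul (leqnn m) r0; have s1 := leq_mul (leqnn m) r1.
have s2 := leq_mul (leqnn m) r2; have s3 := leq_mul (leqnn m) r3.
have sB := leq_mul (leqnn m) b0.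
clear j; lia.
Qed.

(** The recurrence at [l + 2] can reach these two indices, which lie outside the range of the
    maximum. *)
Lemma coefDPn_top (m : nat) : coefDPn m.+3 m.*2.+3 = 1 /\ coefDPn m.+3 m.*2.+4 = 0.
Proof.
have sz : size (char_poly (DPn m.+3)) = m.*2.+4 by rewrite size_char_poly; lia.
split; last by rewrite /coefDPn nth_default ?sz.
by have /monicP := char_poly_monic (DPn m.+3); rewrite lead_coefE sz.
Qed.

Theorem theorem5p14 (n l : nat) (hn : (2 < n)%N) (hl : (l <= 2 * n - 4)%N)
  (hmax : forall i : nat, (i <= 2 * n - 4)%N -> `|coefDPn n i| <= `|coefDPn n l|) :
  (l <= (7 * n) %/ 5)%N.
Proof.
rewrite leqNgt; apply/negP => hlt.
have [m En] : exists m, n = m.+3 by exists (n - 3)%N; lia.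
have [j El] : exists j, l = j.+4 by exists (l - 4)%N; lia.
subst n l.
have h1 : (7 * m.+3 < 5 * j.+4)%N by lia.
have h2 : (j.+4 <= m.*2.+2)%N by lia.
have := coefQ_ratio m j h1 h2.
have := coefDPn_rec m j; have := coefDPn_rec m j.+2.
have [top1 top2] := coefDPn_top m.
have hle i : (i <= m.*2.+2)%N -> `|coefDPn m.+3 i| <= `|coefDPn m.+3 j.+4|.
  by move=> hi; apply: hmax; lia.
have c2 := hle j.+2 (ltnW (ltnW h2)); have c3 := hle j.+3 (ltnW h2).
move=> E2 E0 hQ.
(* If the maximum were 0, [E0] would give [coefQ m j = 0], against [hQ]. Hence it also dominates the
   leading coefficient 1. *)
have c4 : 1 <= `|coefDPn m.+3 j.+4| by lia.
have hle' i : (i <= m.*2.+4)%N -> `|coefDPn m.+3 i| <= `|coefDPn m.+3 j.+4|.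
  rewrite leq_eqVlt => /orP[/eqP->|]; first by rewrite top2; lia.
  rewrite ltnS leq_eqVlt => /orP[/eqP->|]; first by rewrite top1; lia.
  exact: hle.
have c5 := hle' j.+4.+1 (ltnW h2); have c6 := hle' j.+4.+2 h2.
clear hle hle' hmax; lia.
Qed.
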